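(* The model checking problem for the logic $\mathsf{NGL}$ over finite GCGMPs (given a finite GCGMP with integer payoffs, an initial configuration $c$, and an $\mathsf{NGL}$ state formula $\varphi$, decide whether $\mathfrak{M},c\models_{(\mathcal{S}^p,\mathcal{S}^o)}\varphi$) is undecidable when the proponents' strategy class is $\mathcal{S}^p=\mathsf{S}^{pr}$ (perfect-recall state-based strategies) and the opponents' strategy class is $\mathcal{S}^o=\mathsf{S}^{m}$ (memoryless state-based strategies). This holds already for models with two players and formulae without nested strategic modalities, and it holds in each of the following two restricted cases: (i) formulae containing no arithmetic constraints; (ii) models in which all guards are state-based.
   Context: GCGMP (guarded concurrent game model with payoffs): a finite set of players $\mathsf{Ag}$, states $S$, action sets $\mathsf{Act}_a$, a deterministic transition function $\mathsf{out}:S\times\prod_a\mathsf{Act}_a\to S$, atomic propositions $\Pi$ with labelling $\mathsf{L}:S\to 2^\Pi$, a payoff function $\mathsf{payoff}:\mathsf{Ag}\times S\times\prod_a\mathsf{Act}_a\to\mathbb{D}$, for each player $a$ a guard $g_a:S\times\mathsf{Act}_a\to\mathsf{ACF}(X,\{a\})$ (a Boolean combination of comparisons $t_1*t_2$, $*\in\{<,\le,=,\ge,>\}$, between sums of constants from a set $X\ni 0$ and the variable $v_a$ denoting $a$'s accumulated payoff), such that for each state at least one action is enabled for every value of $v_a$, and discount factors $d_a\in[0,1]$. A guard is state-based if it contains no variables (it is a variable-free constraint formula). A configuration is $(s,\vec u)$, $\vec u$ the vector of accumulated payoffs; the transition from $(s,\vec u)$ under profile $\vec\alpha$ at step $l$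 goes to $(\mathsf{out}(s,\vec\alpha),\vec u')$ provided each $u_a$ satisfies $g_a(s,\alpha_a)$, with $u'_a=u_a+d_a^l\,\mathsf{payoff}_a(s,\vec\alpha)$. Plays are infinite sequences of configurations and action profiles following this transition. A strategy of player $a$ maps histories to actions enabled by the guard at the last configuration; a perfect-recall state-based strategy is a function $S^*\to\mathsf{Act}_a$ (depending only on the sequence of states visited), a memoryless state-based strategy is a function $S\to\mathsf{Act}_a$. $\mathsf{NGL}$ state formulae: $\varphi::=p\mid \mathsf{ac}\mid\neg\varphi\mid\varphi\wedge\varphi\mid\langle\langle A\rangle\rangle\mathbf{X}\varphi\mid\langle\langle A\rangle\rangle\mathbf{G}\varphi\mid\langle\langle A\rangle\rangle(\varphi\,\mathbf{U}\,\varphi)$, with $p\in\Pi$, $A\subseteq\mathsf{Ag}$, and $\mathsf{ac}$ an arithmetic constraint over the variables $v_a$. Semantics at a configuration $c$ (step count $l$, initially $1$): $p$ holds iff $p\in\mathsf{L}$ of the state of $c$; $\mathsf{ac}$ holds iff the accumulated payoff vector of $c$ satisfies it; $\langle\langle A\rangle\rangle\gamma$ holds iff there is a collective $\mathcal{S}^p$-strategy for $A$ such that for every collective $\mathcal{S}^o$-strategy of $\mathsf{Ag}\setminus A$ the resulting unique outcome play from $c$ satisfies $\gamma$, where $\mathbf{X},\mathbf{G},\mathbf{U}$ have their usual LTL meaning over the sequence of configurations of the play. *)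

(* Defs.v *)
From Stdlib Require Import ZArith QArith List.
Import ListNotations.

(* Two players (the theorem concerns two-player models).               *)
Inductive agent : Type := Ag1 | Ag2.

Inductive term : Type :=
| TCst : Z -> term            (* a constant (from X, see wellformedness) *)
| TVar : agent -> term
| TAdd : term -> term -> term.

Inductive cmp : Type := CLt | CLe | CEq | CGe | CGt.

Inductive acf : Type :=
| ACmp : cmp -> term -> term -> acf
| ANot : acf -> acf
| AAnd : acf -> acf -> acf.

Fixpoint eval_term (u : agent -> Q) (t : term) : Q :=
  match t with
  | TCst z => inject_Z z
  | TVar a => u a
  | TAdd t1 t2 => eval_term u t1 + eval_term u t2
  end.

Definition eval_cmp (o : cmp) (x y : Q) : Prop :=
  match o with
  | CLt => x < y | CLe => x <= y | CEq => x == y | CGe => y <= x | CGt => y < x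
  end.

Fixpoint acf_sat (u : agent -> Q) (f : acf) : Prop :=
  match f with
  | ACmp o t1 t2 => eval_cmp o (eval_term u t1) (eval_term u t2)
  | ANot f => ~ acf_sat u f
  | AAnd f g => acf_sat u f /\ acf_sat u g
  end.

Fixpoint term_ok (X : list Z) (P : agent -> Prop) (t : term) : Prop :=
  match t with
  | TCst z => In z X
  | TVar a => P a
  | TAdd t1 t2 => term_ok X P t1 /\ term_ok X P t2
  end.

Fixpoint acf_ok (X : list Z) (P : agent -> Prop) (f : acf) : Prop :=
  match f with
  | ACmp _ t1 t2 => term_ok X P t1 /\ term_ok X P t2
  | ANot f => acf_ok X P f
  | AAnd f g => acf_ok X P f /\ acf_ok X P g
  end.

(* Finite two-player GCGMP with integer payoffs.
   States are 0 .. nst-1, actions of player a are 0 .. nact a - 1,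
   atomic propositions are natural numbers.                            *)
Record GCGMP : Type := mkGCGMP {
  nst    : nat;
  nact   : agent -> nat;
  out    : nat -> (agent -> nat) -> nat;
  lab    : nat -> nat -> bool;
  pay    : agent -> nat -> (agent -> nat) -> Z;
  guard  : agent -> nat -> nat -> acf;
  consts : list Z;
  disc   : agent -> Q
}.

Definition profile_ok (M : GCGMP) (al : agent -> nat) : Prop :=
  forall a, (al a < nact M a)%nat.

Definition wf_GCGMP (M : GCGMP) : Prop :=
  (0 < nst M)%nat /\
  (forall s al, (s < nst M)%nat -> profile_ok M al -> (out M s al < nst M)%nat) /\
  In 0%Z (consts M) /\
  (forall a, 0 <= disc M a /\ disc M a <= 1) /\
  (forall a s x, (s < nst M)%nat -> (x < nact M a)%nat ->
      acf_ok (consts M) (fun b => b = a) (guard M a s x)) /\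
  (forall a s (v : Q), (s < nst M)%nat ->
      exists x, (x < nact M a)%nat /\ acf_sat (fun _ => v) (guard M a s x)).

Definition state_based_guards (M : GCGMP) : Prop :=
  forall a s x, (s < nst M)%nat -> (x < nact M a)%nat ->
    acf_ok (consts M) (fun _ => False) (guard M a s x).

Definition enabled (M : GCGMP) (a : agent) (s : nat) (u : agent -> Q) (x : nat) : Prop :=
  (x < nact M a)%nat /\ acf_sat u (guard M a s x).

Definition upd (M : GCGMP) (l : nat) (s : nat) (al : agent -> nat) (u : agent -> Q)
  : agent -> Q :=
  fun a => u a + Qpower (disc M a) (Z.of_nat l) * inject_Z (pay M a s al).

(* Histories from configuration (s0,u0) with step count l, represented by
   the sequence of visited states and the current payoff vector. The
   transition out of the k-th configuration (k = 0,1,...) happens at step l+k. *)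
Inductive hist (M : GCGMP) (s0 : nat) (u0 : agent -> Q) (l : nat)
  : list nat -> (agent -> Q) -> Prop :=
| hist0 : hist M s0 u0 l [s0] u0
| histS : forall ss u al,
    hist M s0 u0 l ss u ->
    (forall a, enabled M a (last ss 0%nat) u (al a)) ->
    hist M s0 u0 l (ss ++ [out M (last ss 0%nat) al])
                   (upd M (l + pred (length ss)) (last ss 0%nat) al u).

Definition legal_pr (M : GCGMP) (s0 : nat) (u0 : agent -> Q) (l : nat) (a : agent)
  (sg : list nat -> nat) : Prop :=
  forall ss u, hist M s0 u0 l ss u -> enabled M a (last ss 0%nat) u (sg ss).

Definition legal_ml (M : GCGMP) (s0 : nat) (u0 : agent -> Q) (l : nat) (a : agent)
  (sg : nat -> nat) : Prop :=
  forall ss u, hist M s0 u0 l ss u ->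
    enabled M a (last ss 0%nat) u (sg (last ss 0%nat)).

(* the combined action function: proponents (A a = true) use their
   perfect-recall strategy, opponents their memoryless one *)
Definition combine (A : agent -> bool) (sp : agent -> list nat -> nat)
  (so : agent -> nat -> nat) : agent -> list nat -> nat :=
  fun a ss => if A a then sp a ss else so a (last ss 0%nat).

(* prefix of length n+1 of the outcome play *)
Fixpoint run (M : GCGMP) (s0 : nat) (u0 : agent -> Q) (l : nat)
  (act : agent -> list nat -> nat) (n : nat) : list nat * (agent -> Q) :=
  match n with
  | O => ([s0], u0)
  | S n' =>
      let r := run M s0 u0 l act n' in
      let ss := fst r in
      let s := last ss 0%nat in
      let al := fun a => act a ss in
      (ss ++ [out M s al], upd M (l + n') s al (snd r))
  end.

Inductive form : Type :=
| FProp : nat -> form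
| FAc   : acf -> form
| FNot  : form -> form
| FAnd  : form -> form -> form
| FX    : (agent -> bool) -> form -> form
| FG    : (agent -> bool) -> form -> form
| FU    : (agent -> bool) -> form -> form -> form.

(* M, (s,u) |= phi  with step count l, for (S^p, S^o) = (S^pr, S^m) *)
Fixpoint sat (M : GCGMP) (s : nat) (u : agent -> Q) (l : nat) (f : form) : Prop :=
  let strat (A : agent -> bool) (goal : (nat -> list nat * (agent -> Q)) -> Prop) :=
    exists sp : agent -> list nat -> nat,
      (forall a, A a = true -> legal_pr M s u l a (sp a)) /\
      forall so : agent -> nat -> nat,
        (forall a, A a = false -> legal_ml M s u l a (so a)) ->
        goal (run M s u l (combine A sp so)) in
  match f with
  | FProp p => lab M s p = true
  | FAc c => acf_sat u c
  | FNot g => ~ sat M s u l g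
  | FAnd g h => sat M s u l g /\ sat M s u l h
  | FX A g => strat A (fun pl =>
        sat M (last (fst (pl 1%nat)) 0%nat) (snd (pl 1%nat)) (l + 1) g)
  | FG A g => strat A (fun pl => forall i,
        sat M (last (fst (pl i)) 0%nat) (snd (pl i)) (l + i) g)
  | FU A g h => strat A (fun pl => exists i,
        sat M (last (fst (pl i)) 0%nat) (snd (pl i)) (l + i) h /\
        forall j, (j < i)%nat ->
          sat M (last (fst (pl j)) 0%nat) (snd (pl j)) (l + j) g)
  end.

Fixpoint no_strat (f : form) : Prop :=
  match f with
  | FProp _ | FAc _ => True
  | FNot g => no_strat g
  | FAnd g h => no_strat g /\ no_strat h
  | FX _ _ | FG _ _ | FU _ _ _ => False
  end.

Fixpoint no_nesting (f : form) : Prop :=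
  match f with
  | FProp _ | FAc _ => True
  | FNot g => no_nesting g
  | FAnd g h => no_nesting g /\ no_nesting h
  | FX _ g | FG _ g => no_strat g
  | FU _ g h => no_strat g /\ no_strat h
  end.

Fixpoint no_ac (f : form) : Prop :=
  match f with
  | FProp _ => True
  | FAc _ => False
  | FNot g | FX _ g | FG _ g => no_ac g
  | FAnd g h | FU _ g h => no_ac g /\ no_ac h
  end.

Fixpoint form_ok (X : list Z) (f : form) : Prop :=
  match f with
  | FProp _ => True
  | FAc c => acf_ok X (fun _ => True) c
  | FNot g | FX _ g | FG _ g => form_ok X g
  | FAnd g h | FU _ g h => form_ok X g /\ form_ok X h
  end.

Record MCinstance : Type := mkInst {
  i_model : GCGMP;
  i_state : nat;
  i_pay   : agent -> Z;
  i_form  : form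
}.

Definition MC (x : MCinstance) : Prop :=
  sat (i_model x) (i_state x) (fun a => inject_Z (i_pay x a)) 1%nat (i_form x).

Definition basic_ok (x : MCinstance) : Prop :=
  wf_GCGMP (i_model x) /\ (i_state x < nst (i_model x))%nat /\
  form_ok (consts (i_model x)) (i_form x) /\ no_nesting (i_form x).

Definition case_no_ac (x : MCinstance) : Prop :=
  basic_ok x /\ no_ac (i_form x).

Definition case_state_guards (x : MCinstance) : Prop :=
  basic_ok x /\ state_based_guards (i_model x).

(* Synthetic (un)decidability, as in the Coq Library of Undecidability
   Proofs: decidability = existence of a boolean decider; undecidability
   of a problem = its decidability would decide a known undecidable
   problem, here halting of Minsky two-counter machines.               *)
Definition decidable {X : Type} (P : X -> Prop) : Prop :=
  exists f : X -> bool, forall x, P x <-> f x = true.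

(* decidability of Q on the promise domain D *)
Definition decidable_on {X : Type} (D Q : X -> Prop) : Prop :=
  exists f : X -> bool, forall x, D x -> (Q x <-> f x = true).

(* Two-counter machines: counters indexed by bool; halting = the program
   counter leaves the program. *)
Inductive cm_instr : Type :=
| CInc : bool -> nat -> cm_instr            (* increment r, goto j *)
| CDec : bool -> nat -> nat -> cm_instr.    (* if r = 0 goto k else decrement r, goto j *)

Definition cm_conf : Type := (nat * nat * nat)%type.  (* pc, counter false, counter true *)

Definition cm_step (P : list cm_instr) (c : cm_conf) : cm_conf :=
  let '(pc, c0, c1) := c in
  match nth_error P pc with
  | None => c
  | Some (CInc false j) => (j, S c0, c1)
  | Some (CInc true j) => (j, c0, S c1)
  | Some (CDec false j k) =>
      match c0 with O => (k, c0, c1) | S c0' => (j, c0', c1) end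
  | Some (CDec true j k) =>
      match c1 with O => (k, c0, c1) | S c1' => (j, c0, c1') end
  end.

Definition CM_HALT (P : list cm_instr) : Prop :=
  exists n, let '(pc, _, _) := Nat.iter n (cm_step P) (0%nat, 0%nat, 0%nat) in
            (length P <= pc)%nat.

Definition undecidable_on {X : Type} (D Q : X -> Prop) : Prop :=
  decidable_on D Q -> decidable CM_HALT.

(* Main.v *)
(* Given a program P, we build a two-player GCGMP whose states are
   3 * pc + t: the program counter pc (capped at |P|, the halting zone) and a
   tag t, where t = 1 + r records that the last move took the zero branch of
   counter r.  Player Ag1 (resp. Ag2) holds counter false (resp. true) in its
   accumulated payoff: increments pay +1, decrements pay -1 (discounts are 1).
   At a decrement on counter r the player owning r chooses between the
   decrement branch (action 1) and the zero branch (action 0).  A play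
   simulates the machine as long as these choices are truthful.  Truthfulness
   is enforced in one of two ways:
   (i)  by guards "action 1 iff v_a >= 1", with the constraint-free formula
        <<Ag>>(true U halted);
   (ii) by the formula <<Ag>>(ok U (halted /\ ok)), ok stating that payoffs
        are nonnegative and vanish right after a zero branch, with trivial
        (state-based) guards. *)

Require Import Defs.
From Stdlib Require Import ZArith QArith Qpower List Lia Bool.
Import ListNotations.
Open Scope nat_scope.

Lemma undecidable_by_reduction {X : Type} (D Q : X -> Prop)
  (inst : list cm_instr -> X) :
  (forall P, D (inst P)) -> (forall P, Q (inst P) <-> CM_HALT P) ->
  undecidable_on D Q.
Proof.
  intros HD HQ [f Hf]. exists (fun P => f (inst P)).
  intros P. rewrite <- HQ. apply Hf, HD.
Qed.

Section Plays.
Variables (M : GCGMP) (s0 : nat) (u0 : agent -> Q) (l : nat)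
  (act : agent -> list nat -> nat).

Definition play_state (k : nat) : nat := last (fst (run M s0 u0 l act k)) 0.
Definition play_pay (k : nat) : agent -> Q := snd (run M s0 u0 l act k).
Definition play_profile (k : nat) : agent -> nat :=
  fun a => act a (fst (run M s0 u0 l act k)).

Lemma play_state_S k :
  play_state (S k) = out M (play_state k) (play_profile k).
Proof. apply last_last. Qed.

Lemma play_pay_S k :
  play_pay (S k) = upd M (l + k) (play_state k) (play_profile k) (play_pay k).
Proof. reflexivity. Qed.

Lemma run_length k : length (fst (run M s0 u0 l act k)) = S k.
Proof.
  induction k as [|k IH]; [reflexivity|].
  cbn [run fst]. rewrite length_app, IH. cbn. lia.
Qed.

Lemma run_is_history :
  (forall a ss u, hist M s0 u0 l ss u -> enabled M a (last ss 0) u (act a ss)) ->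
  forall k, hist M s0 u0 l (fst (run M s0 u0 l act k)) (play_pay k).
Proof.
  intros Hlegal k. induction k as [|k IH]; [constructor|].
  pose proof (histS M s0 u0 l _ _ (play_profile k) IH (fun a => Hlegal a _ _ IH)) as H.
  rewrite run_length in H. exact H.
Qed.

Lemma hist_length ss u : hist M s0 u0 l ss u -> 1 <= length ss.
Proof. intros Hh. destruct Hh; cbn; rewrite ?length_app; cbn; lia. Qed.
End Plays.

Definition pc_of (c : cm_conf) : nat := let '(pc, _, _) := c in pc.
Definition counter (c : cm_conf) (r : bool) : nat :=
  let '(_, c0, c1) := c in if r then c1 else c0.
Definition cm_iter (P : list cm_instr) (n : nat) : cm_conf :=
  Nat.iter n (cm_step P) (0, 0, 0).

Lemma cm_halt_iff P : CM_HALT P <-> exists n, length P <= pc_of (cm_iter P n).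
Proof.
  unfold CM_HALT, cm_iter.
  split; intros [n Hn]; exists n; destruct (Nat.iter n _ _) as [[pc c0] c1]; exact Hn.
Qed.

Lemma cm_step_spec P c :
  match nth_error P (pc_of c) with
  | None => cm_step P c = c
  | Some (CInc r j) => pc_of (cm_step P c) = j /\
      forall r', Z.of_nat (counter (cm_step P c) r') =
                 (Z.of_nat (counter c r') + if Bool.eqb r r' then 1 else 0)%Z
  | Some (CDec r j k) => pc_of (cm_step P c) = (if 0 <? counter c r then j else k) /\
      forall r', Z.of_nat (counter (cm_step P c) r') =
                 (Z.of_nat (counter c r') - if Bool.eqb r r' && (0 <? counter c r)%nat then 1 else 0)%Z
  end.
Proof.
  destruct c as [[pc c0] c1]. unfold cm_step. cbn [pc_of].
  destruct (nth_error P pc) as [[[|] j|[|] j k]|]; try reflexivity;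
    [| | destruct c1 | destruct c0];
    split; try reflexivity; intros [|]; cbn -[Z.of_nat]; lia.
Qed.

Definition reg (a : agent) : bool := match a with Ag1 => false | Ag2 => true end.
Definition ag (r : bool) : agent := if r then Ag2 else Ag1.
Lemma reg_ag r : reg (ag r) = r.
Proof. now destruct r. Qed.

(* Tag of the states entered through the zero branch of counter r. *)
Definition zero_tag (r : bool) : nat := if r then 2 else 1.
Lemma zero_tag_lt r : zero_tag r < 3.
Proof. destruct r; cbn; lia. Qed.
Lemma zero_tag_inj r r' : zero_tag r = zero_tag r' -> r = r'.
Proof. now destruct r, r'. Qed.

Definition always : acf := ACmp CEq (TCst 0) (TCst 0).
Definition positivity_guard (a : agent) (x : nat) : acf :=
  if x =? 1 then ACmp CLe (TCst 1) (TVar a) else ACmp CLt (TVar a) (TCst 1).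

Lemma positivity_guard_sat u a x (n : nat) :
  u a == inject_Z (Z.of_nat n) ->
  acf_sat u (positivity_guard a x) <-> (x =? 1) = (0 <? n).
Proof.
  intros Hu. unfold positivity_guard.
  destruct (x =? 1); cbn [acf_sat eval_cmp eval_term]; rewrite Hu;
    [rewrite <- Zle_Qle | rewrite <- Zlt_Qlt];
    destruct n; cbn -[Z.of_nat]; split; intros H; try discriminate; lia.
Qed.

Section Model.
Variable P : list cm_instr.

Definition node (pc t : nat) : nat := 3 * Nat.min pc (length P) + t.
Lemma node_div pc t : t < 3 -> node pc t / 3 = Nat.min pc (length P).
Proof. intros Ht. symmetry. apply (Nat.div_unique _ _ _ t); unfold node; lia. Qed.
Lemma node_mod pc t : t < 3 -> node pc t mod 3 = t.
Proof. intros Ht. symmetry. apply (Nat.mod_unique _ _ (Nat.min pc (length P)) t); unfold node; lia. Qed.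

Lemma instr_min pc : nth_error P (Nat.min pc (length P)) = nth_error P pc.
Proof.
  destruct (Nat.le_gt_cases (length P) pc).
  - rewrite Nat.min_r by lia. rewrite !(proj2 (nth_error_None _ _)) by lia. reflexivity.
  - now rewrite Nat.min_l by lia.
Qed.

Definition claims_positive (al : agent -> nat) (r : bool) : bool := al (ag r) =? 1.

(* Transitions, payoffs and labels: proposition 0 marks the halting zone,
   proposition t > 0 marks the states with tag t. *)
Definition mout (s : nat) (al : agent -> nat) : nat :=
  match nth_error P (s / 3) with
  | None => s
  | Some (CInc _ j) => node j 0
  | Some (CDec r j k) => if claims_positive al r then node j 0 else node k (zero_tag r)
  end.

Definition mpay (a : agent) (s : nat) (al : agent -> nat) : Z :=
  match nth_error P (s / 3) with
  | None => 0
  | Some (CInc r _) => if Bool.eqb r (reg a) then 1 else 0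
  | Some (CDec r _ _) => if Bool.eqb r (reg a) && claims_positive al r then -1 else 0
  end%Z.

Definition mlab (s p : nat) : bool :=
  match p with 0 => length P <=? s / 3 | _ => s mod 3 =? p end.

(* [guarded] selects between positivity guards (case i) and trivial
   guards (case ii); all discounts are 1. *)
Definition model (guarded : bool) : GCGMP :=
  mkGCGMP (3 * S (length P)) (fun _ => 2) mout mlab mpay
    (fun a _ x => if guarded then positivity_guard a x else always)
    [0%Z; 1%Z] (fun _ => 1%Q).

Lemma upd_model g l s al u a :
  upd (model g) l s al u a == u a + inject_Z (mpay a s al).
Proof. unfold upd; cbn [model disc pay]. rewrite Qpower_1. ring. Qed.

Record simulates (c : cm_conf) (s : nat) (u : agent -> Q) : Prop := {
  sim_pc : s / 3 = Nat.min (pc_of c) (length P);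
  sim_counter : forall a, u a == inject_Z (Z.of_nat (counter c (reg a)));
  sim_zero : forall r, s mod 3 = zero_tag r -> counter c r = 0 }.

Definition truthful (c : cm_conf) (al : agent -> nat) : Prop :=
  match nth_error P (pc_of c) with
  | Some (CDec r _ _) => claims_positive al r = (0 <? counter c r)
  | _ => True
  end.

Lemma simulates_step g l c s u al :
  simulates c s u -> truthful c al ->
  simulates (cm_step P c) (mout s al) (upd (model g) l s al u).
Proof.
  intros [Hs Hu Hz] Ht. unfold truthful in Ht.
  pose proof (cm_step_spec P c) as Hspec.
  assert (Hpay : forall a, upd (model g) l s al u a ==
            inject_Z (Z.of_nat (counter c (reg a)) + mpay a s al)).
  { intros a. now rewrite upd_model, Hu, inject_Z_plus. }
  unfold mout; unfold mpay in Hpay.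
  rewrite Hs, instr_min in *.
  destruct (nth_error P (pc_of c)) as [[r j|r j k]|].
  - destruct Hspec as [Hpc Hcnt]. constructor.
    + rewrite node_div, Hpc; lia.
    + intros a. now rewrite Hpay, Hcnt.
    + rewrite node_mod by lia. intros [|] H; discriminate.
  - destruct Hspec as [Hpc Hcnt]. rewrite Ht in *.
    destruct (0 <? counter c r) eqn:Hpos; constructor.
    + rewrite node_div, Hpc; lia.
    + intros a. rewrite Hpay, Hcnt. now destruct (Bool.eqb r (reg a)).
    + rewrite node_mod by lia. intros [|] H; discriminate.
    + rewrite node_div, Hpc by apply zero_tag_lt. reflexivity.
    + intros a. rewrite Hpay, Hcnt, andb_false_r. now destruct (Bool.eqb r (reg a)).
    + rewrite node_mod by apply zero_tag_lt. intros r' Hr'.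
      apply zero_tag_inj in Hr'. subst r'. apply Nat.ltb_ge in Hpos.
      specialize (Hcnt r). rewrite andb_false_r in Hcnt. lia.
  - rewrite Hspec. constructor; auto. intros a. now rewrite Hpay, Z.add_0_r.
Qed.

Lemma guards_force_truth c s u al :
  simulates c s u -> (forall a, enabled (model true) a s u (al a)) -> truthful c al.
Proof.
  intros Hsim Hen. unfold truthful.
  destruct (nth_error P (pc_of c)) as [[r j|r j k]|]; trivial.
  destruct (Hen (ag r)) as [_ Hg]. cbn [model guard] in Hg.
  rewrite (positivity_guard_sat _ _ _ _ (sim_counter _ _ _ Hsim (ag r))), reg_ag in Hg.
  exact Hg.
Qed.

Definition report (c : cm_conf) (a : agent) : nat := if 0 <? counter c (reg a) then 1 else 0.

Lemma report_truthful c : truthful c (report c).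
Proof.
  unfold truthful, claims_positive, report.
  destruct (nth_error P (pc_of c)) as [[r j|r j k]|]; trivial.
  rewrite reg_ag. now destruct (0 <? counter c r).
Qed.

Lemma report_enabled g c s u a : simulates c s u -> enabled (model g) a s u (report c a).
Proof.
  intros Hsim. split.
  - cbn. unfold report. destruct (0 <? _); lia.
  - cbn [model guard]. destruct g; [|reflexivity].
    rewrite (positivity_guard_sat _ _ _ _ (sim_counter _ _ _ Hsim a)).
    unfold report. now destruct (0 <? counter c (reg a)).
Qed.

Lemma simulates_initial : simulates (0, 0, 0) 0 (fun _ => inject_Z 0).
Proof. constructor; [reflexivity | intros a; now destruct a | now intros [|]]. Qed.

Lemma halted_iff c s u : simulates c s u -> mlab s 0 = true <-> length P <= pc_of c.
Proof. intros Hsim. unfold mlab. rewrite Nat.leb_le, (sim_pc _ _ _ Hsim). lia. Qed.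

Lemma histories_simulate s0 u0 l ss u :
  simulates (0, 0, 0) s0 u0 -> hist (model true) s0 u0 l ss u ->
  simulates (cm_iter P (length ss - 1)) (last ss 0) u.
Proof.
  intros H0 Hh. induction Hh as [|ss u al Hh IH Hen]; [exact H0|].
  rewrite last_last, length_app. cbn [length].
  pose proof (hist_length _ _ _ _ _ _ Hh).
  replace (length ss + 1 - 1) with (S (length ss - 1)) by lia.
  apply simulates_step; [exact IH|]. exact (guards_force_truth _ _ _ _ IH Hen).
Qed.

Lemma play_simulates g s0 u0 l act n :
  simulates (0, 0, 0) s0 u0 ->
  (forall k, k < n -> simulates (cm_iter P k) (play_state (model g) s0 u0 l act k)
                                 (play_pay (model g) s0 u0 l act k) ->
             truthful (cm_iter P k) (play_profile (model g) s0 u0 l act k)) ->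
  simulates (cm_iter P n) (play_state (model g) s0 u0 l act n) (play_pay (model g) s0 u0 l act n).
Proof.
  intros H0 Htruth. induction n as [|n IH]; [exact H0|].
  rewrite play_state_S, play_pay_S.
  assert (Hn : simulates (cm_iter P n) (play_state (model g) s0 u0 l act n)
                 (play_pay (model g) s0 u0 l act n)) by (apply IH; auto).
  apply simulates_step; auto.
Qed.
End Model.

(* The formulae.  [counter_ok a]: v_a >= 0, and v_a = 0 in states reached
   by the zero branch of a's counter. *)
Definition everyone : agent -> bool := fun _ => true.
Definition halted : form := FProp 0.
Definition ftrue : form := FNot (FAnd halted (FNot halted)).
Definition counter_ok (a : agent) : form :=
  FAnd (FAc (ACmp CLe (TCst 0) (TVar a)))
       (FNot (FAnd (FProp (zero_tag (reg a))) (FNot (FAc (ACmp CEq (TVar a) (TCst 0)))))).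
Definition counters_ok : form := FAnd (counter_ok Ag1) (counter_ok Ag2).

Lemma sat_counters_ok P g s u l :
  sat (model P g) s u l counters_ok <->
  forall a, (0 <= u a)%Q /\ (s mod 3 = zero_tag (reg a) -> (u a == 0)%Q).
Proof.
  assert (Hone : forall a, sat (model P g) s u l (counter_ok a) <->
                 (0 <= u a)%Q /\ (s mod 3 = zero_tag (reg a) -> (u a == 0)%Q)).
  { intros a. cbn [sat counter_ok acf_sat eval_cmp eval_term model lab].
    replace (mlab P s (zero_tag (reg a))) with (s mod 3 =? zero_tag (reg a))
      by now destruct (reg a).
    rewrite Nat.eqb_eq. destruct (Qeq_dec (u a) (inject_Z 0)); intuition. }
  cbn [sat counters_ok]. rewrite !Hone.
  split; [intros [H1 H2] [|]; assumption | intros H; split; apply H].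
Qed.

Lemma simulates_counters_ok P g c s u l :
  simulates P c s u -> sat (model P g) s u l counters_ok.
Proof.
  intros [_ Hu Hz]. apply sat_counters_ok. intros a. rewrite Hu. split.
  - change (inject_Z 0 <= inject_Z (Z.of_nat (counter c (reg a))))%Q.
    rewrite <- Zle_Qle. lia.
  - intros Ht. now rewrite (Hz _ Ht).
Qed.

(* If the successor configuration satisfies [counters_ok], the move was
   truthful: a false decrement makes a payoff negative, a false zero branch
   lands in a zero-tagged state with a positive payoff. *)
Lemma counters_ok_force_truth P g c s u al l l' :
  simulates P c s u ->
  sat (model P g) (mout P s al) (upd (model P g) l s al u) l' counters_ok ->
  truthful P c al.
Proof.
  intros Hsim Hok. rewrite sat_counters_ok in Hok. unfold truthful.
  destruct (nth_error P (pc_of c)) as [[r j|r j k]|] eqn:E; trivial.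
  destruct (Hok (ag r)) as [Hnonneg Hzero]. clear Hok.
  rewrite upd_model, (sim_counter _ _ _ _ Hsim), reg_ag in Hnonneg, Hzero.
  unfold mout, mpay in *. rewrite (sim_pc _ _ _ _ Hsim), instr_min, E, reg_ag, eqb_reflx in *.
  change 0%Q with (inject_Z 0) in Hnonneg, Hzero.
  rewrite <- inject_Z_plus in Hnonneg, Hzero.
  destruct (claims_positive al r); cbn [andb] in *.
  - rewrite <- Zle_Qle in Hnonneg.
    symmetry. apply Nat.ltb_lt. lia.
  - rewrite node_mod in Hzero by apply zero_tag_lt.
    specialize (Hzero eq_refl). rewrite inject_Z_injective in Hzero.
    symmetry. apply Nat.ltb_ge. lia.
Qed.

(* The two model-checking instances built from P.  All agents are proponents. *)
Definition reach_halt : form := FU everyone ftrue halted.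
Definition reach_halt_safely : form := FU everyone counters_ok (FAnd halted counters_ok).

Definition instance (P : list cm_instr) (guarded : bool) (phi : form) : MCinstance :=
  mkInst (model P guarded) 0 (fun _ => 0%Z) phi.

Definition truthful_strategy (P : list cm_instr) (a : agent) (ss : list nat) : nat :=
  report (cm_iter P (length ss - 1)) a.

Lemma truthful_play P g so n :
  simulates P (cm_iter P n)
    (play_state (model P g) 0 (fun _ => inject_Z 0) 1 (Defs.combine everyone (truthful_strategy P) so) n)
    (play_pay (model P g) 0 (fun _ => inject_Z 0) 1 (Defs.combine everyone (truthful_strategy P) so) n).
Proof.
  apply play_simulates; [apply simulates_initial|]. intros k _ _.
  unfold play_profile, Defs.combine, truthful_strategy; cbn [everyone].
  rewrite run_length. replace (S k - 1) with k by lia. apply report_truthful.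
Qed.

Lemma mc_guarded P : MC (instance P true reach_halt) <-> CM_HALT P.
Proof.
  rewrite cm_halt_iff. unfold MC. cbn [instance i_model i_state i_pay i_form reach_halt sat].
  split.
  - intros [sp [Hlegal Hplay]].
    destruct (Hplay (fun _ _ => 0)) as [i [Hhalt _]]; [intros a Ha; discriminate|].
    pose proof (run_is_history (model P true) 0 (fun _ => inject_Z 0) 1
      (Defs.combine everyone sp (fun _ _ => 0)) (fun a _ _ Hh => Hlegal a eq_refl _ _ Hh) i) as Hhist.
    pose proof (histories_simulate P _ _ _ _ _ (simulates_initial P) Hhist) as Hsim.
    rewrite run_length in Hsim. replace (S i - 1) with i in Hsim by lia.
    exists i. exact (proj1 (halted_iff _ _ _ _ Hsim) Hhalt).
  - intros [n Hn]. exists (truthful_strategy P). split.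
    + intros a _ ss u Hh. apply report_enabled.
      exact (histories_simulate P _ _ _ _ _ (simulates_initial P) Hh).
    + intros so _. exists n. split.
      * exact (proj2 (halted_iff _ _ _ _ (truthful_play P true so n)) Hn).
      * intros j _ [Hh Hnh]. contradiction.
Qed.

Lemma mc_checked P : MC (instance P false reach_halt_safely) <-> CM_HALT P.
Proof.
  rewrite cm_halt_iff. unfold MC.
  cbn [instance i_model i_state i_pay i_form reach_halt_safely sat].
  split.
  - intros [sp [_ Hplay]].
    destruct (Hplay (fun _ _ => 0)) as [i [[Hhalt Hlast] Hbefore]]; [intros a Ha; discriminate|].
    set (act := Defs.combine everyone sp (fun _ _ => 0)).
    assert (Hok : forall k, k <= i ->
      sat (model P false) (play_state (model P false) 0 (fun _ => inject_Z 0) 1 act k)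
        (play_pay (model P false) 0 (fun _ => inject_Z 0) 1 act k) (1 + k) counters_ok).
    { intros k Hk. destruct (Nat.eq_dec k i) as [->|Hne]; [exact Hlast | apply Hbefore; lia]. }
    assert (Htruth : forall k, k < i ->
      simulates P (cm_iter P k) (play_state (model P false) 0 (fun _ => inject_Z 0) 1 act k)
        (play_pay (model P false) 0 (fun _ => inject_Z 0) 1 act k) ->
      truthful P (cm_iter P k) (play_profile (model P false) 0 (fun _ => inject_Z 0) 1 act k)).
    { intros k Hk Hsim. specialize (Hok (S k) Hk).
      rewrite play_state_S, play_pay_S in Hok. exact (counters_ok_force_truth _ _ _ _ _ _ _ _ Hsim Hok). }
    exists i. apply (halted_iff _ _ _ _ (play_simulates P false _ _ 1 act i (simulates_initial P) Htruth)).
    exact Hhalt.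
  - intros [n Hn]. exists (truthful_strategy P). split.
    + intros a _ ss u _. split; [|reflexivity]. cbn. unfold truthful_strategy, report.
      destruct (0 <? _); lia.
    + intros so _. exists n. split; [split|].
      * exact (proj2 (halted_iff _ _ _ _ (truthful_play P false so n)) Hn).
      * exact (simulates_counters_ok _ _ _ _ _ _ (truthful_play P false so n)).
      * intros j _. exact (simulates_counters_ok _ _ _ _ _ _ (truthful_play P false so j)).
Qed.

Lemma model_wf P g : wf_GCGMP (model P g).
Proof.
  assert (Hnode : forall pc t, t < 3 -> node P pc t < 3 * S (length P))
    by (intros pc t Ht; unfold node; lia).
  unfold wf_GCGMP; cbn [model nst nact out consts disc guard].
  split; [lia|]. split; [|split; [now left|split; [|split]]].
  - intros s al Hs _. unfold mout.
    destruct (nth_error P (s / 3)) as [[r j|r j k]|]; auto.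
    destruct (claims_positive al r); apply Hnode; auto using zero_tag_lt.
  - intros a. split; unfold Qle; cbn; lia.
  - intros a s x _ _. destruct g; [unfold positivity_guard; destruct (x =? 1)|]; cbn; auto.
  - intros a s v _. destruct g; [|exists 0; split; [lia|reflexivity]].
    destruct (Qlt_le_dec v 1); [exists 0 | exists 1]; split; auto.
Qed.

Lemma instance_basic_ok P g phi :
  form_ok [0%Z; 1%Z] phi -> no_nesting phi -> basic_ok (instance P g phi).
Proof.
  intros Hform Hnest. split; [apply model_wf|]. split; [cbn; lia|]. now split.
Qed.

Theorem mainTheorem2 :
  undecidable_on case_no_ac MC /\ undecidable_on case_state_guards MC.
Proof.
  split.
  - apply (undecidable_by_reduction _ _ (fun P => instance P true reach_halt)).
    + intros P. split; [apply instance_basic_ok|]; cbn; tauto.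
    + apply mc_guarded.
  - apply (undecidable_by_reduction _ _ (fun P => instance P false reach_halt_safely)).
    + intros P. split; [apply instance_basic_ok; cbn; tauto|].
      intros a s x _ _. cbn. auto.
    + apply mc_checked.
Qed.
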